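(* Let $H$ be a Hopf algebra and let $A$ be a (nonzero) right $H$-comodule Poisson 3-Lie algebra which is Poisson $H$-simple. Then $A^{AcoH}$ is a field.
   Context: Everything is over a fixed field $k$ of characteristic 0; algebras are associative and unital. Right $H$-coactions are written $\rho(a)=a_{(0)}\otimes a_{(1)}$. A 3-Lie algebra is a vector space $A$ with a skew-symmetric trilinear bracket $\{-,-,-\}:A^{\otimes 3}\to A$ satisfying $\{\{x,y,z\},u,v\}=\{\{x,u,v\},y,z\}+\{\{y,u,v\},z,x\}+\{\{z,u,v\},x,y\}$. A Poisson 3-Lie algebra is a commutative associative algebra $A$ with a 3-Lie bracket such that $\{x,y,uv\}=u\{x,y,v\}+\{x,y,u\}v$. A right $H$-comodule Poisson 3-Lie algebra is a Poisson 3-Lie algebra $A$ that is a right $H$-comodule algebra with $\rho(\{x,y,z\})=\{x_{(0)},y_{(0)},z_{(0)}\}\otimes x_{(1)}y_{(1)}z_{(1)}$. $A^A=\{b\in A:\{b,A,A\}=0\}$, $A^{coH}=\{a\in A:\rho(a)=a\otimes 1_H\}$, and $A^{AcoH}=A^A\cap A^{coH}$. A subspace $I$ of $A$ is a Poisson 3-Lie $H$-ideal if it is an ideal of the commutative algebra $A$, a 3-Lie ideal ($\{I,A,A\}\subseteq I$), and an $H$-subcomodule of $A$. $A$ is Poisson $H$-simple if its only Poisson 3-Lie $H$-ideals are $0$ and $A$. *)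

(* Defs.v *)
From HB Require Import structures.
From mathcomp Require Import all_boot all_order all_algebra.
From mathcomp Require Import boolp classical_sets.

Set Implicit Arguments.
Unset Strict Implicit.
Unset Printing Implicit Defensive.

Import GRing.Theory.
Local Open Scope quotient_scope.
Local Open Scope ring_scope.

(* A list [:: (u1, v1); ...; (un, vn)] stands for the formal sum of the
   u_i (x) v_i.  U (x) V is the set of formal sums modulo the smallest
   congruence (for concatenation) that makes the sum commutative and (x)
   bilinear; tlift_pure, tlift_linear and tens_ind below give the universal
   property. *)
Section TensorProduct.
Variables (k : fieldType) (U V : lmodType k).

Inductive tens_rel : seq (U * V) -> seq (U * V) -> Prop :=
| tens_refl s : tens_rel s s
| tens_sym s t : tens_rel s t -> tens_rel t s
| tens_trans s t r : tens_rel s t -> tens_rel t r -> tens_rel s r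
| tens_cat s s' t t' :
    tens_rel s s' -> tens_rel t t' -> tens_rel (s ++ t) (s' ++ t')
| tens_comm s t : tens_rel (s ++ t) (t ++ s)
| tens_zerol v : tens_rel [:: (0, v)] [::]
| tens_addl u u' v : tens_rel [:: (u + u', v)] [:: (u, v); (u', v)]
| tens_addr u v v' : tens_rel [:: (u, v + v')] [:: (u, v); (u, v')]
| tens_scale c u v : tens_rel [:: (c *: u, v)] [:: (u, c *: v)].

Definition tens_relb (s t : seq (U * V)) : bool := `[< tens_rel s t >].

Lemma tens_relb_refl : reflexive tens_relb.
Proof. by move=> s; apply/asboolP/tens_refl. Qed.

Lemma tens_relb_sym : symmetric tens_relb.
Proof. by move=> s t; apply/asboolP/asboolP; apply: tens_sym. Qed.

Lemma tens_relb_trans : transitive tens_relb.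
Proof.
by move=> t s r /asboolP st /asboolP tr; apply/asboolP; apply: tens_trans tr.
Qed.

Canonical tens_equiv :=
  EquivRel tens_relb tens_relb_refl tens_relb_sym tens_relb_trans.

Definition tens := {eq_quot tens_relb}.
HB.instance Definition _ := Choice.on tens.
HB.instance Definition _ := EqQuotient.on tens.

Lemma tens_eqP (s t : seq (U * V)) : \pi_tens s = \pi_tens t <-> tens_rel s t.
Proof.
split=> [/eqP|st]; first by rewrite piE => /asboolP.
by apply/eqP; rewrite piE; apply/asboolP.
Qed.

Lemma repr_rel (s : seq (U * V)) : tens_rel (repr (\pi_tens s)) s.
Proof. by apply/tens_eqP; rewrite reprK. Qed.

Definition scale_sum (c : k) (s : seq (U * V)) := [seq (c *: p.1, p.2) | p <- s].

Lemma scale_sum_rel c s t :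
  tens_rel s t -> tens_rel (scale_sum c s) (scale_sum c t).
Proof.
elim=> {s t} [s|s t _|s t r _ st _|s s' t t' _ ss _|s t|v|u u' v|u v v'|d u v].
- exact: tens_refl.
- exact: tens_sym.
- exact: tens_trans.
- by rewrite /scale_sum !map_cat => tt; apply: tens_cat.
- by rewrite /scale_sum !map_cat; apply: tens_comm.
- by rewrite /= scaler0; apply: tens_zerol.
- by rewrite /= scalerDr; apply: tens_addl.
- exact: tens_addr.
- by rewrite /= scalerA mulrC -scalerA; apply: tens_scale.
Qed.

Definition tens0 : tens := \pi_tens [::].
Definition tens_add (x y : tens) : tens := \pi_tens (repr x ++ repr y).
Definition tens_scl (c : k) (x : tens) : tens := \pi_tens (scale_sum c (repr x)).
Definition tens_opp (x : tens) : tens := tens_scl (-1) x.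

Lemma tens_addE s t : tens_add (\pi_tens s) (\pi_tens t) = \pi_tens (s ++ t).
Proof. by apply/tens_eqP/tens_cat; apply: repr_rel. Qed.

Lemma tens_sclE c s : tens_scl c (\pi_tens s) = \pi_tens (scale_sum c s).
Proof. by apply/tens_eqP/scale_sum_rel/repr_rel. Qed.

Lemma tens_addA : associative tens_add.
Proof.
elim/quotW=> s; elim/quotW=> t; elim/quotW=> r.
by rewrite (tens_addE t r) (tens_addE s t) !tens_addE catA.
Qed.

Lemma tens_addC : commutative tens_add.
Proof.
elim/quotW=> s; elim/quotW=> t; rewrite (tens_addE s t) (tens_addE t s).
by apply/tens_eqP; apply: tens_comm.
Qed.

Lemma tens_add0 : left_id tens0 tens_add.
Proof. by elim/quotW=> s; rewrite tens_addE. Qed.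

Lemma tens_sclDl x (c d : k) :
  tens_scl (c + d) x = tens_add (tens_scl c x) (tens_scl d x).
Proof.
elim/quotW: x => s.
rewrite (tens_sclE c s) (tens_sclE d s) tens_sclE tens_addE; apply/tens_eqP.
elim: s => [|[u v] s IH] /=; first exact: tens_refl.
rewrite -cat1s scalerDl.
apply: tens_trans (tens_cat (tens_addl _ _ _) IH) _ => /=.
rewrite -(cat1s (c *: u, v)) -(cat1s (c *: u, v) (_ ++ _)).
apply: tens_cat; first exact: tens_refl.
rewrite -cat1s -(cat1s (d *: u, v) (scale_sum d s)) !catA.
by apply: tens_cat; [apply: tens_comm | apply: tens_refl].
Qed.

Lemma tens_scl0 x : tens_scl 0 x = tens0.
Proof.
elim/quotW: x => s; rewrite tens_sclE; apply/tens_eqP.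
elim: s => [|[u v] s IH] /=; first exact: tens_refl.
rewrite scale0r -cat1s -[[::]]/([::] ++ [::] : seq (U * V)).
by apply: tens_cat => //; apply: tens_zerol.
Qed.

Lemma tens_scl1 : left_id 1 tens_scl.
Proof.
elim/quotW=> s; rewrite tens_sclE; congr \pi_tens.
by rewrite /scale_sum -[RHS]map_id; apply: eq_map => -[u v]; rewrite scale1r.
Qed.

Lemma tens_addN : left_inverse tens0 tens_opp tens_add.
Proof.
move=> x; rewrite /tens_opp -{2}[x]tens_scl1 -tens_sclDl addNr.
exact: tens_scl0.
Qed.

HB.instance Definition _ :=
  GRing.isZmodule.Build tens tens_addA tens_addC tens_add0 tens_addN.

Lemma tens_sclA c d x : tens_scl c (tens_scl d x) = tens_scl (c * d) x.
Proof.
elim/quotW: x => s; rewrite (tens_sclE d s) !tens_sclE; congr \pi_tens.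
by rewrite /scale_sum -map_comp; apply: eq_map => -[u v] /=; rewrite scalerA.
Qed.

Lemma tens_sclDr : right_distributive tens_scl +%R.
Proof.
move=> c; elim/quotW=> s; elim/quotW=> t.
change (tens_scl c (tens_add (\pi s) (\pi t)) =
  tens_add (tens_scl c (\pi s)) (tens_scl c (\pi t))).
rewrite (tens_addE s t) (tens_sclE c s) (tens_sclE c t) tens_sclE tens_addE.
by rewrite /scale_sum map_cat.
Qed.

HB.instance Definition _ := GRing.Zmodule_isLmodule.Build k tens
  tens_sclA tens_scl1 tens_sclDr (fun x c d => tens_sclDl x c d).

Definition pure (u : U) (v : V) : tens := \pi_tens [:: (u, v)].

Lemma tens_pi s : \pi_tens s = \sum_(p <- s) pure p.1 p.2.
Proof.
elim: s => [|[u v] s IH]; rewrite ?big_nil // big_cons -IH.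
by rewrite -cat1s -tens_addE.
Qed.

Lemma tens_reprE (x : tens) : x = \sum_(p <- repr x) pure p.1 p.2.
Proof. by rewrite -tens_pi reprK. Qed.

Lemma tens_ind (P : tens -> Prop) : P 0 ->
  (forall u v x, P x -> P (pure u v + x)) -> forall x, P x.
Proof.
move=> P0 PD x; rewrite [x]tens_reprE.
elim: (repr x) => [|p s IH]; rewrite ?big_nil // big_cons; exact: PD.
Qed.

Lemma pure_linearl v : linear (pure^~ v).
Proof.
move=> c u u'; change (pure (c *: u + u') v =
  tens_add (tens_scl c (pure u v)) (pure u' v)).
rewrite tens_sclE tens_addE; by apply/tens_eqP; apply: tens_addl.
Qed.

Lemma pure_linearr u : linear (pure u).
Proof.
move=> c v v'; change (pure u (c *: v + v') =
  tens_add (tens_scl c (pure u v)) (pure u v')).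
rewrite (tens_sclE c) tens_addE; apply/tens_eqP.
apply: tens_trans (tens_addr _ _ _) _.
rewrite -cat1s -[X in tens_rel _ X]cat1s.
by apply: tens_cat; [apply/tens_sym/tens_scale | apply: tens_refl].
Qed.

(* Sweedler notation: tlift (fun u v => f u v) x is the sum of the f u_i v_i
   for a decomposition x = sum_i u_i (x) v_i.  For bilinear f the value does
   not depend on the decomposition (tlift_sum). *)
Definition tlift (W : nmodType) (f : U -> V -> W) (x : tens) : W :=
  \sum_(p <- repr x) f p.1 p.2.

Section Lift.
Variables (W : lmodType k) (f : U -> V -> W).
Hypotheses (fl : forall v, linear (f^~ v)) (fr : forall u, linear (f u)).

Lemma tlift_rel s t :
  tens_rel s t -> \sum_(p <- s) f p.1 p.2 = \sum_(p <- t) f p.1 p.2.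
Proof.
have flD u u' v : f (u + u') v = f u v + f u' v.
  by have := fl v 1 u u'; rewrite !scale1r.
have frD u v v' : f u (v + v') = f u v + f u v'.
  by have := fr u 1 v v'; rewrite !scale1r.
have fl0 v : f 0 v = 0 by apply: (addrI (f 0 v)); rewrite -flD !addr0.
have fr0 u : f u 0 = 0 by apply: (addrI (f u 0)); rewrite -frD !addr0.
elim=> {s t} [s|s t _|s t r _ st _|s s' t t' _ ss _|s t|v|u u' v|u v v'|c u v].
- by [].
- by [].
- by rewrite st.
- by rewrite !big_cat /= ss => ->.
- by rewrite !big_cat /= addrC.
- by rewrite big_seq1 big_nil fl0.
- by rewrite !big_cons !big_nil /= !addr0 flD.
- by rewrite !big_cons !big_nil /= !addr0 frD.
- rewrite !big_seq1 /=.
  by have := fl v c u 0; have := fr u c v 0; rewrite !addr0 fl0 fr0 !addr0 => -> ->.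
Qed.

Lemma tlift_sum s :
  tlift f (\sum_(p <- s) pure p.1 p.2) = \sum_(p <- s) f p.1 p.2.
Proof. by rewrite -tens_pi; apply/tlift_rel/repr_rel. Qed.

Lemma tlift_pure u v : tlift f (pure u v) = f u v.
Proof. by have := tlift_sum [:: (u, v)]; rewrite !big_seq1. Qed.

Lemma tlift_linear : linear (tlift f).
Proof.
move=> c x y; rewrite {1}[x]tens_reprE {1}[y]tens_reprE.
have -> : c *: (\sum_(p <- repr x) pure p.1 p.2) =
    \sum_(p <- scale_sum c (repr x)) pure p.1 p.2.
  rewrite -!tens_pi; exact: tens_sclE.
rewrite -big_cat tlift_sum big_cat; congr (_ + _).
rewrite big_map scaler_sumr; apply: eq_bigr => p _ /=.
have f0 : f 0 p.2 = 0.
  by apply: (addrI (f 0 p.2)); have := fl p.2 1 0 0; rewrite !scale1r !addr0.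
by have := fl p.2 c p.1 0; rewrite f0 !addr0.
Qed.

End Lift.

End TensorProduct.

Arguments tens {k} U V.
Arguments pure {k U V} u v.

Notation "u \ox v" := (pure u v) (at level 40, left associativity) : ring_scope.

Definition tens_mul (k : fieldType) (A B : algType k) (x y : tens A B) :
    tens A B :=
  tlift (fun a b => tlift (fun a' b' => (a * a') \ox (b * b')) y) x.

(* Equality of (Delta (x) id) Delta and (id (x) Delta) Delta (resp. of
   (rho (x) id) rho and (id (x) Delta) rho below) is stated in the
   right-bracketed product: the left-hand sides contain the associativity
   isomorphism (u (x) v) (x) w |-> u (x) (v (x) w). *)
Record hopf_algebra (k : fieldType) (H : algType k)
    (Delta : {linear H -> tens H H}) (eps : {scalar H})
    (S : {linear H -> H}) : Prop := {
  hopf_coassoc : forall h,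
    tlift (fun h1 h2 => tlift (fun h11 h12 => h11 \ox (h12 \ox h2)) (Delta h1))
      (Delta h)
    = tlift (fun h1 h2 => h1 \ox Delta h2) (Delta h);
  hopf_counitl : forall h, tlift (fun h1 h2 => eps h1 *: h2) (Delta h) = h;
  hopf_counitr : forall h, tlift (fun h1 h2 => eps h2 *: h1) (Delta h) = h;
  hopf_Delta1 : Delta 1 = 1 \ox 1;
  hopf_DeltaM : forall g h, Delta (g * h) = tens_mul (Delta g) (Delta h);
  hopf_eps1 : eps 1 = 1;
  hopf_epsM : forall g h, eps (g * h) = eps g * eps h;
  hopf_antipodel : forall h,
    tlift (fun h1 h2 => S h1 * h2) (Delta h) = (eps h)%:A;
  hopf_antipoder : forall h,
    tlift (fun h1 h2 => h1 * S h2) (Delta h) = (eps h)%:A }.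

Record lie3_algebra (k : fieldType) (A : lmodType k)
    (br : A -> A -> A -> A) : Prop := {
  lie3_linear1 : forall y z, linear (fun x => br x y z);
  lie3_linear2 : forall x z, linear (fun y => br x y z);
  lie3_linear3 : forall x y, linear (fun z => br x y z);
  lie3_skew12 : forall x y z, br y x z = - br x y z;
  lie3_skew23 : forall x y z, br x z y = - br x y z;
  lie3_jacobi : forall x y z u v,
    br (br x y z) u v =
      br (br x u v) y z + br (br y u v) z x + br (br z u v) x y }.

Record poisson_lie3_algebra (k : fieldType) (A : comAlgType k)
    (br : A -> A -> A -> A) : Prop := {
  poisson_lie3 : lie3_algebra br;
  poisson_leibniz : forall x y u v,
    br x y (u * v) = u * br x y v + br x y u * v }.

Record comodule_algebra (k : fieldType) (H A : algType k)
    (Delta : {linear H -> tens H H}) (eps : {scalar H})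
    (rho : {linear A -> tens A H}) : Prop := {
  comodule_coassoc : forall a,
    tlift (fun a0 a1 => tlift (fun a00 a01 => a00 \ox (a01 \ox a1)) (rho a0))
      (rho a)
    = tlift (fun a0 a1 => a0 \ox Delta a1) (rho a);
  comodule_counit : forall a, tlift (fun a0 a1 => eps a1 *: a0) (rho a) = a;
  comodule_rho1 : rho 1 = 1 \ox 1;
  comodule_rhoM : forall a b, rho (a * b) = tens_mul (rho a) (rho b) }.

Record comodule_poisson_lie3_algebra (k : fieldType) (H : algType k)
    (A : comAlgType k) (Delta : {linear H -> tens H H}) (eps : {scalar H})
    (br : A -> A -> A -> A) (rho : {linear A -> tens A H}) : Prop := {
  cpl3_poisson : poisson_lie3_algebra br;
  cpl3_comodule : comodule_algebra Delta eps rho;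
  cpl3_bracket : forall x y z,
    rho (br x y z) =
      tlift (fun x0 x1 => tlift (fun y0 y1 => tlift (fun z0 z1 =>
        br x0 y0 z0 \ox (x1 * y1 * z1)) (rho z)) (rho y)) (rho x) }.

Section Invariants.
Variables (k : fieldType) (H : algType k) (A : comAlgType k).
Variables (br : A -> A -> A -> A) (rho : {linear A -> tens A H}).

Definition casimir : set A := [set b | forall x y, br b x y = 0].

Definition coinvariant : set A := [set a | rho a = a \ox 1].

Definition casimir_coinvariant : set A := (casimir `&` coinvariant)%classic.

(* The last field is rho(I) <= I (x) H, where I (x) H is identified with its
   image in A (x) H. *)
Record poisson_H_ideal (I : set A) : Prop := {
  phi_zero : I 0;
  phi_add : forall a b, I a -> I b -> I (a + b);
  phi_scale : forall (c : k) a, I a -> I (c *: a);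
  phi_mul : forall a b, I b -> I (a * b);
  phi_bracket : forall a x y, I a -> I (br a x y);
  phi_subcomodule : forall a, I a -> exists2 s : seq (A * H),
    (forall p, p \in s -> I p.1) & rho a = \sum_(p <- s) p.1 \ox p.2 }.

Definition poisson_H_simple : Prop :=
  forall I : set A, poisson_H_ideal I -> I = [set 0]%classic \/ I = setT.

End Invariants.

(* K, with the operations of A, is a field: commutativity and 1 != 0 are
   inherited from A. *)
Record is_field (A : comNzRingType) (K : set A) : Prop := {
  is_field1 : K 1;
  is_fieldB : forall a b, K a -> K b -> K (a - b);
  is_fieldM : forall a b, K a -> K b -> K (a * b);
  is_fieldV : forall a, K a -> a != 0 -> exists2 b, K b & a * b = 1 }.

(* Main.v *)
Require Import Defs.
From HB Require Import structures.
From mathcomp Require Import all_boot all_order all_algebra.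
From mathcomp Require Import boolp classical_sets.

(** For a nonzero Casimir coinvariant [a], the principal ideal [a A] is a
    Poisson 3-Lie [H]-ideal, because [{a b, x, y} = a {b, x, y}] and
    [rho (a b) = (a (x) 1) rho b].  By simplicity [a b = 1] for some [b], and
    the same two identities, multiplied by [b] (resp. [b (x) 1]), show that [b]
    is again a Casimir coinvariant. *)

Set Implicit Arguments.
Unset Strict Implicit.
Unset Printing Implicit Defensive.

Import GRing.Theory.
Local Open Scope ring_scope.

Section TensMul.
Variables (k : fieldType) (A B : algType k).

(** Taking an arbitrary formal sum, not just the chosen representative, lets the formula apply to
    any decomposition of a tensor. Bilinearity of both nested lifts makes the value independent of
    that choice. *)
Lemma tens_mul_pure1l (a : A) (s : seq (A * B)) :
  tens_mul (a \ox 1) (\sum_(p <- s) p.1 \ox p.2)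
  = \sum_(p <- s) (a * p.1) \ox p.2.
Proof.
rewrite /tens_mul tlift_pure; first last.
- move=> u c v v'; rewrite /tlift scaler_sumr -big_split.
  by apply: eq_bigr => p _; rewrite mulrDl -scalerAl pure_linearr.
- move=> v c u u'; rewrite /tlift scaler_sumr -big_split.
  by apply: eq_bigr => p _; rewrite mulrDl -scalerAl pure_linearl.
rewrite tlift_sum; first by apply: eq_bigr => p _; rewrite mul1r.
- by move=> v c u u'; rewrite mulrDr -scalerAr pure_linearl.
- by move=> u c v v'; rewrite mulrDr -scalerAr pure_linearr.
Qed.

Lemma tens_mul_pure1_pure (a u : A) (v : B) :
  tens_mul (a \ox 1) (u \ox v) = (a * u) \ox v.
Proof. by have := tens_mul_pure1l a [:: (u, v)]; rewrite !big_seq1. Qed.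

(** The instance of associativity of [tens_mul] on which the inversion argument for coinvariants
    rests. *)
Lemma tens_mul_pure1_comp (a b : A) (x : tens A B) :
  tens_mul (a \ox 1) (tens_mul (b \ox 1) x) = tens_mul ((a * b) \ox 1) x.
Proof.
rewrite [x]tens_reprE !tens_mul_pure1l.
(* The inner product has summands [(b * p.1) \ox p.2]; reindexing over the mapped list gives it the
   shape to which the formula applies again. *)
have := tens_mul_pure1l a [seq (b * p.1, p.2) | p <- repr x].
rewrite !big_map /= => ->.
by apply: eq_bigr => p _; rewrite mulrA.
Qed.

Lemma tens_mul_pure11 (x : tens A B) : tens_mul (1 \ox 1) x = x.
Proof.
rewrite [x in LHS]tens_reprE tens_mul_pure1l [RHS]tens_reprE.
by apply: eq_bigr => p _; rewrite mul1r.
Qed.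

End TensMul.

Section PoissonLie3.
Variables (k : fieldType) (A : comAlgType k) (br : A -> A -> A -> A).
Hypothesis poissonA : poisson_lie3_algebra br.

(** A 3-cycle is a product of two transpositions. This carries the Leibniz rule from the last
    argument to the first. *)
Lemma lie3_cyclic x y z : br x y z = br y z x.
Proof.
have lieA := poisson_lie3 poissonA.
by rewrite (lie3_skew23 lieA y x z) (lie3_skew12 lieA x y z) opprK.
Qed.

Lemma poisson_leibniz1 u v x y : br (u * v) x y = u * br v x y + br u x y * v.
Proof. by rewrite !(lie3_cyclic _ x y) poisson_leibniz. Qed.

Lemma casimir_mull a b x y : casimir br a -> br (a * b) x y = a * br b x y.
Proof. by move=> aC; rewrite poisson_leibniz1 aC mul0r addr0. Qed.

(** Leibniz on [1 * 1] gives [d = d + d] for [d = br 1 x y]. *)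
Lemma casimir1 : casimir br 1.
Proof.
move=> x y; have := poisson_leibniz1 1 1 x y; rewrite !mulr1 mul1r => /eqP.
by rewrite -subr_eq0 opprD addrA subrr sub0r oppr_eq0 => /eqP.
Qed.

Lemma casimirB a b : casimir br a -> casimir br b -> casimir br (a - b).
Proof.
move=> aC bC x y; have := lie3_linear1 (poisson_lie3 poissonA) x y (-1) b a.
by rewrite /= !scaleN1r => lin; rewrite addrC lin aC bC oppr0 addr0.
Qed.

Lemma casimirM a b : casimir br a -> casimir br b -> casimir br (a * b).
Proof. by move=> aC bC x y; rewrite casimir_mull // bC mulr0. Qed.

(** [br b x y = (a * br b x y) * b = br (a * b) x y * b = br 1 x y * b = 0]. *)
Lemma casimirV a b : a * b = 1 -> casimir br a -> casimir br b.
Proof.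
move=> ab aC x y.
by rewrite -[LHS]mul1r -ab mulrAC -casimir_mull // ab casimir1 mul0r.
Qed.

End PoissonLie3.

Section Coinvariants.
Variables (k : fieldType) (H : algType k) (A : comAlgType k).
Variables (Delta : {linear H -> tens H H}) (eps : {scalar H}).
Variable rho : {linear A -> tens A H}.
Hypothesis comodA : comodule_algebra Delta eps rho.

Lemma coinvariantB a b :
  coinvariant rho a -> coinvariant rho b -> coinvariant rho (a - b).
Proof.
rewrite /coinvariant /= => aC bC; rewrite linearB aC bC /=.
have := pure_linearl (1 : H) (-1) b a.
by rewrite !scaleN1r (addrC _ a) => ->; rewrite addrC.
Qed.

Lemma coinvariant_mull a b :
  coinvariant rho a -> rho (a * b) = tens_mul (a \ox 1) (rho b).
Proof. by move=> aC; rewrite (comodule_rhoM comodA) aC. Qed.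

Lemma coinvariantM a b :
  coinvariant rho a -> coinvariant rho b -> coinvariant rho (a * b).
Proof.
move=> aC bC; rewrite /coinvariant /= coinvariant_mull // bC.
exact: tens_mul_pure1_pure.
Qed.

(** With products in [tens A H]: [rho b = (b \ox 1) (a \ox 1) (rho b) = (b \ox 1) (rho (a * b)) = (b
    \ox 1) (1 \ox 1) = b \ox 1]. *)
Lemma coinvariantV a b : a * b = 1 -> coinvariant rho a -> coinvariant rho b.
Proof.
move=> ab aC; rewrite /coinvariant /= -[LHS]tens_mul_pure11 -ab mulrC.
rewrite -tens_mul_pure1_comp -coinvariant_mull // ab (comodule_rho1 comodA).
by rewrite tens_mul_pure1_pure mulr1.
Qed.

End Coinvariants.

Lemma principal_poisson_H_ideal (k : fieldType) (H : algType k)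
    (A : comAlgType k) (Delta : {linear H -> tens H H}) (eps : {scalar H})
    (br : A -> A -> A -> A) (rho : {linear A -> tens A H}) (a : A) :
  comodule_poisson_lie3_algebra Delta eps br rho ->
  casimir_coinvariant br rho a ->
  poisson_H_ideal br rho [set c | exists b, c = a * b]%classic.
Proof.
move=> [poissonA comodA _] [aC aI]; split.
- by exists 0; rewrite mulr0.
- by move=> _ _ [b ->] [c ->]; exists (b + c); rewrite mulrDr.
- by move=> c _ [b ->]; exists (c *: b); rewrite scalerAr.
- by move=> c _ [b ->]; exists (c * b); rewrite mulrCA.
- by move=> _ x y [b ->]; exists (br b x y); rewrite casimir_mull.
(* Multiplying the left legs of a decomposition of [rho b] by [a] puts them in the ideal and yields
   [(a \ox 1) (rho b) = rho (a * b)]. *)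
- move=> _ [b ->]; exists [seq (a * p.1, p.2) | p <- repr (rho b)].
    by move=> _ /mapP[p _ ->]; exists p.1.
  by rewrite (coinvariant_mull comodA) // big_map [rho b]tens_reprE
    tens_mul_pure1l -tens_reprE.
Qed.

Theorem lemma3p8 (k : fieldType) (k_char0 : [pchar k] =i pred0)
    (H : algType k) (Delta : {linear H -> tens H H}) (eps : {scalar H})
    (S : {linear H -> H}) (hopfH : hopf_algebra Delta eps S)
    (A : comAlgType k) (br : A -> A -> A -> A) (rho : {linear A -> tens A H})
    (poissonA : comodule_poisson_lie3_algebra Delta eps br rho)
    (simpleA : poisson_H_simple br rho) :
  is_field (casimir_coinvariant br rho).
Proof.
have [pA cA _] := poissonA; split.
- by split; [apply: casimir1 | apply: comodule_rho1 cA].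
- by move=> a b [aC aI] [bC bI]; split; [apply: casimirB | apply: coinvariantB].
- move=> a b [aC aI] [bC bI].
  by split; [apply: casimirM | apply: (coinvariantM cA)].
- move=> a [aC aI] a_neq0.
  case: (simpleA _ (principal_poisson_H_ideal poissonA (conj aC aI))) => aAE.
    (* The ideal contains [a = a * 1], so it cannot be zero. *)
    suff a0 : [set 0 : A]%classic a by rewrite a0 eqxx in a_neq0.
    by rewrite -aAE; exists 1; rewrite mulr1.
  (* The ideal is all of [A], so it contains [1], which provides the inverse. *)
  have [b ab] : [set c | exists b, c = a * b]%classic 1 by rewrite aAE.
  by exists b => //; split; [apply: casimirV aC | apply: (coinvariantV cA) aI].
Qed.
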